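(* For every positive integer $n$ such that $\frac{n}{2}$ is an even integer, $\gamma(n,\frac{n}{2},\frac{n}{2})\leq\frac{n}{2}$. Moreover, there is a constant $0<\delta<1$ such that $\gamma(n,\frac{n}{2},\frac{n}{2})\geq\delta n$ whenever $n/2$ is even and $n/4$ is odd.
   Context: $[n]=\{1,\ldots,n\}$. A bicoloring of $[n]$ is a map $B:[n]\to\{-1,+1\}$; it is a $k$-bicoloring if it takes the value $+1$ on exactly $k$ points. Put $Y_B=(B(1),\ldots,B(n))$, and for $A\subseteq[n]$ let $X_A\in\{0,1\}^n$ be its incidence vector. A non-empty set $A\subseteq[n]$ is an unbiased representative for $B$ if $\langle X_A,Y_B\rangle=0$. A family $\mathcal{A}$ of subsets of $[n]$ is a system of unbiased representatives (SUR) for a set $\mathcal{B}$ of bicolorings if every $B\in\mathcal{B}$ has an unbiased representative in $\mathcal{A}$. $\gamma(n,k,r)$ is the maximum, over all sets $\mathcal{B}$ of $k$-bicolorings of $[n]$, of the minimum cardinality of a SUR for $\mathcal{B}$ all of whose members have cardinality exactly $r$; equivalently, it is this minimum cardinality when $\mathcal{B}$ is the set of all $\binom{n}{k}$ $k$-bicolorings. *)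

(* Defs.v *)
From mathcomp Require Import all_boot all_order all_algebra.
From mathcomp Require Import reals.

Set Implicit Arguments.
Unset Strict Implicit.
Unset Printing Implicit Defensive.

Import Order.TTheory GRing.Theory Num.Theory.

(* The ground set [n] is 'I_n.  The two colors +1 and -1 are encoded by       *)
(* [true] and [false]; [color] gives the actual value.                        *)
Definition bicoloring (n : nat) := {ffun 'I_n -> bool}.

Definition color (b : bool) : int := (if b then 1 else -1)%R.

Definition k_bicolorings (n k : nat) : {set bicoloring n} :=
  [set B : bicoloring n | #|[set i | color (B i) == 1%R]| == k].

Definition color_vector (n : nat) (B : bicoloring n) : 'rV[int]_n :=
  (\row_i color (B i))%R.

Definition incidence_vector (n : nat) (A : {set 'I_n}) : 'rV[int]_n :=
  (\row_i (i \in A)%:R)%R.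

Definition inner_product (n : nat) (u v : 'rV[int]_n) : int :=
  (\sum_(i < n) u ord0 i * v ord0 i)%R.

Definition unbiased_representative (n : nat) (A : {set 'I_n})
    (B : bicoloring n) : bool :=
  (A != set0) && (inner_product (incidence_vector A) (color_vector B) == 0%R).

Definition is_SUR (n : nat) (F : {set {set 'I_n}})
    (BB : {set bicoloring n}) : bool :=
  [forall B in BB, exists A in F, unbiased_representative A B].

Definition r_sets (n r : nat) : {set {set 'I_n}} :=
  [set A : {set 'I_n} | #|A| == r].

Definition is_uniform_SUR (n r : nat) (F : {set {set 'I_n}})
    (BB : {set bicoloring n}) : bool :=
  (F \subset r_sets n r) && is_SUR F BB.

(* [r_sets n r], the starting point of the arg min, is an r-uniform SUR as    *)
(* soon as there is one ([r_sets_SUR]), so this is the minimum whenever that  *)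
(* minimum exists; otherwise the value is a meaningless default.              *)
Definition min_SUR_card (n r : nat) (BB : {set bicoloring n}) : nat :=
  #|[arg min_(F < r_sets n r | is_uniform_SUR r F BB) #|F|]|.

Definition gamma (n k r : nat) : nat :=
  \max_(BB : {set bicoloring n} | BB \subset k_bicolorings n k)
    min_SUR_card r BB.

Lemma r_sets_SUR (n r : nat) (F : {set {set 'I_n}}) (BB : {set bicoloring n}) :
  is_uniform_SUR r F BB -> is_uniform_SUR r (r_sets n r) BB.
Proof.
case/andP=> sF /forall_inP sur; rewrite /is_uniform_SUR subxx /=.
apply/forall_inP=> B BBB; have /exists_inP[A AF uA] := sur B BBB.
by apply/exists_inP; exists A => //; apply: (subsetP sF).
Qed.

Lemma min_SUR_cardP (n r : nat) (F : {set {set 'I_n}})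
    (BB : {set bicoloring n}) : is_uniform_SUR r F BB ->
  (exists2 G : {set {set 'I_n}}, is_uniform_SUR r G BB
     & min_SUR_card r BB = #|G|) /\ min_SUR_card r BB <= #|F|.
Proof.
move=> surF; rewrite /min_SUR_card; case: arg_minnP; first exact: r_sets_SUR surF.
by move=> G surG minG; split; [exists G | exact: minG].
Qed.

Lemma inner_productE (n : nat) (A : {set 'I_n}) (B : bicoloring n) :
  inner_product (incidence_vector A) (color_vector B)
  = (#|A :&: [set i | B i]|%:Z - #|A :\: [set i | B i]|%:Z)%R.
Proof.
rewrite /inner_product (bigID (fun i => i \in A)) /=.
rewrite [X in (_ + X)%R]big1 ?addr0; last first.
  by move=> i /negbTE iA; rewrite !mxE iA mul0r.
under eq_bigr => i iA do rewrite !mxE iA mul1r.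
rewrite (bigID (fun i => B i)) /=; congr (_ + _)%R.
  under eq_bigr => i /andP[_ Bi] do rewrite Bi /=.
  rewrite sumr_const -natz; congr (_ *+ _)%R.
  by apply: eq_card => i; rewrite !inE.
under eq_bigr => i /andP[_ /negbTE Bi] do rewrite Bi /=.
rewrite sumr_const mulNrn -natz; congr (- (_ *+ _))%R.
by apply: eq_card => i; rewrite !inE andbC.
Qed.

(* In the range of parameters of interest the default is never used.          *)
Lemma r_sets_half_SUR (n : nat) (BB : {set bicoloring n}) :
  0 < n -> 2 %| n -> ~~ odd (n %/ 2) ->
  BB \subset k_bicolorings n (n %/ 2) ->
  is_uniform_SUR (n %/ 2) (r_sets n (n %/ 2)) BB.
Proof.
move=> n_gt0 n_even half_even sBB; rewrite /is_uniform_SUR subxx /=.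
apply/forall_inP=> B /(subsetP sBB); rewrite inE => /eqP cardB.
set P := [set i | B i]; set h := n %/ 2 in half_even cardB *.
have cardP : #|P| = h.
  by rewrite -cardB; apply: eq_card => i; rewrite !inE; case: (B i).
have n_def : n = h + h by rewrite addnn -muln2 divnK.
have cardN : #|~: P| = h by rewrite cardsCs setCK card_ord cardP n_def addnK.
have h_def : h = h./2 + h./2 by rewrite addnn even_halfK.
have h2_le : h./2 <= h by rewrite {2}h_def leq_addr.
have half_subset (S : {set 'I_n}) : #|S| = h ->
    exists2 T : {set 'I_n}, T \subset S & #|T| = h./2.
  move=> cardS; exists [set x in take h./2 (enum S)].
    by apply/subsetP=> x; rewrite inE => /mem_take; rewrite mem_enum.
  rewrite cardsE (card_uniqP _) ?take_uniq ?enum_uniq //.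
  by rewrite size_takel // -cardE cardS.
have [S sSP cS] := half_subset P cardP.
have [T sTN cT] := half_subset (~: P) cardN.
have STP : (S :|: T) :&: P = S.
  apply/setP=> i; have := subsetP sSP i; have := subsetP sTN i.
  rewrite !inE; case: (i \in S); case: (i \in T); case: (B i) => //= H1 H2;
    solve [by have := H1 isT | by have := H2 isT].
have STD : (S :|: T) :\: P = T.
  apply/setP=> i; have := subsetP sSP i; have := subsetP sTN i.
  rewrite !inE; case: (i \in S); case: (i \in T); case: (B i) => //= H1 H2;
    solve [by have := H1 isT | by have := H2 isT].
have cST : #|S :|: T| = h by rewrite -(cardsID P) STP STD cS cT -h_def.
apply/exists_inP; exists (S :|: T); first by rewrite inE cST.
rewrite /unbiased_representative inner_productE STP STD cS cT subrr eqxx andbT.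
rewrite -card_gt0 cST; by case: h n_def n_gt0 {half_even cardB cardP cardN h_def h2_le half_subset cS cT cST} => [->|].
Qed.

(* Main.v *)
(* Write n = 2h.  Upper bound: among the windows {i, ..., i+h-1} with i < h, one
   meets a given h-set in exactly h/2 points, by a discrete intermediate value
   argument.

   Lower bound: h/2 is odd, so a small family G of h-sets fails as soon as some
   h-set meets every member of G in an even number of points.  Pigeonhole and
   maximality give an even T, of even size, such that u = h - |T| lies between
   h/8 and h/4.  It is completed by an even u-subset U of the complement S of T.
   To find U, count the even u-subsets of S by characters: up to a factor 2^|G|
   the count is a sum of 2^|G| Krawtchouk values K(j), where K(j) is the
   coefficient of X^u in (1-X)^j (1+X)^(m-j), m = |S|.  As u is well below m/2,
   the three-term recurrence in j makes K positive and geometrically decreasing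
   for j <= h/12; a quadratic energy, nonincreasing up to m/2, keeps |K(j)|
   exponentially small compared with K(0) up to m/2; and K(m-j) = K(j) because u
   is even.  The term K(0) therefore dominates when |G| is a small multiple
   of n. *)
Require Import Defs.
From mathcomp Require Import all_boot all_order all_algebra.
From mathcomp Require Import reals.
From mathcomp Require Import zify ring lra.

Set Implicit Arguments.
Unset Strict Implicit.
Unset Printing Implicit Defensive.

Import Order.TTheory GRing.Theory Num.Theory.

(** * Upper bound: sliding windows *)

(** Bounding upward steps is enough: a step from below [c] to at least [c] lands on [c]. *)
Lemma unit_step_ivt (f : nat -> nat) (c n : nat) :
  (forall i, f i.+1 <= (f i).+1) -> f 0 <= c <= f n ->
  exists2 i, i <= n & f i = c.
Proof.
move=> step; elim: n => [|n IHn] /andP[f0c cfn].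
  by exists 0 => //; apply/eqP; rewrite eqn_leq f0c.
have [cfn'|fn'c] := leqP c (f n).
  by have [i le_in fi] := IHn (introT andP (conj f0c cfn')); exists i => //; lia.
by exists n.+1 => //; have := step n; lia.
Qed.

Definition window (n h i : nat) : {set 'I_n} := [set x : 'I_n | i <= x < i + h].

Lemma card_window (n h i : nat) : i + h <= n -> #|window n h i| = h.
Proof.
move=> ihn; rewrite cardsE cardE -(size_map val).
transitivity (size (iota i h)); last by rewrite size_iota.
apply/perm_size/uniq_perm.
- by rewrite map_inj_uniq ?enum_uniq //; apply: val_inj.
- exact: iota_uniq.
move=> x; rewrite mem_iota; apply/mapP/idP => [[y]|xi].
  by rewrite mem_enum => yi ->.
have xn : x < n by lia.
by exists (Ordinal xn); rewrite // mem_enum.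
Qed.

Lemma window_step (n h i : nat) (P : {set 'I_n}) :
  #|window n h i.+1 :&: P| <= (#|window n h i :&: P|).+1.
Proof.
have [ihn|nih] := ltnP (i + h) n.
  rewrite -[X in _ <= X]add1n -(cards1 (Ordinal ihn)).
  apply: leq_trans (leq_of_leqif (leq_card_setU _ _)).
  apply/subset_leq_card/subsetP => x; rewrite !inE -val_eqE /=.
  by case: (x \in P); lia.
apply: leqW; apply/subset_leq_card/subsetP => x; rewrite !inE.
by have := ltn_ord x; case: (x \in P); lia.
Qed.

(* Sliding the window from [0, h) to its complement [h, 2h) turns an
   intersection of size x into one of size h - x, in steps of at most 1. *)
Lemma balanced_window (h : nat) (P : {set 'I_(h + h)}) :
  0 < h -> ~~ odd h -> #|P| = h ->
  exists2 i, i < h & #|window (h + h) h i :&: P| = h./2.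
Proof.
move=> h0 evh cP; pose f Q i := #|window (h + h) h i :&: Q|.
have fC i : i <= h -> f P i + f (~: P) i = h.
  by move=> ih; rewrite /f -setDE cardsID card_window //; lia.
have f0h : f P 0 + f P h = h.
  rewrite /f -[RHS]cP -(cardsID (window (h + h) h 0) P) setIC; congr (_ + _).
  apply: eq_card => x; rewrite !inE.
  by have := ltn_ord x; case: (x \in P); lia.
suff [i ih fi] : exists2 i, i <= h & f P i = h./2.
  have [lt_ih|le_hi] := ltnP i h; first by exists i.
  (* Windows 0 and [h] are complementary, so a hit at [h] is also a hit at 0. This leaves [h]
     windows instead of [h + 1]. *)
  by exists 0 => //; rewrite -/(f P 0); have ? : i = h by [lia]; subst i; lia.
have [le0|gt0] := leqP (f P 0) h./2.
  by apply: unit_step_ivt => [i|]; [apply: window_step | lia].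
have := fC 0 (leq0n h); have := fC h (leqnn h) => fCh fC0.
have [|i ih fi] := @unit_step_ivt (f (~: P)) h./2 h (fun i => window_step h i _).
  lia.
by exists i => //; have := fC i ih; lia.
Qed.

Lemma unbiased_representativeE (n h : nat) (A : {set 'I_n}) (B : bicoloring n) :
  0 < h -> ~~ odd h -> #|A| = h ->
  unbiased_representative A B = (#|A :&: [set i | B i]| == h./2).
Proof.
move=> h0 evh cA; rewrite /unbiased_representative -card_gt0 cA h0 /=.
rewrite inner_productE subr_eq0 eqz_nat.
have : #|A :&: [set i | B i]| + #|A :\: [set i | B i]| = h by rewrite cardsID.
by move: #|A :&: _| #|A :\: _| => x y; lia.
Qed.

Lemma k_bicoloringsE (n k : nat) (B : bicoloring n) :
  (B \in k_bicolorings n k) = (#|[set i | B i]| == k).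
Proof.
rewrite inE; congr (_ == _); apply: eq_card => i.
by rewrite !inE; case: (B i).
Qed.

Lemma gamma_half_le (h : nat) :
  0 < h -> ~~ odd h -> gamma (h + h) h h <= h.
Proof.
move=> h0 evh; apply/bigmax_leqP => BB /subsetP sBB.
pose F := [set window (h + h) h i | i : 'I_h].
apply: (@leq_trans #|F|); last first.
  by apply: leq_trans (leq_imset_card _ _) _; rewrite card_ord.
apply: (min_SUR_cardP _).2; apply/andP; split.
  apply/subsetP => _ /imsetP[i _ ->]; rewrite inE card_window //.
  by have := ltn_ord i; lia.
apply/forall_inP => B /sBB; rewrite k_bicoloringsE => /eqP cB.
have [i ih e] := balanced_window h0 evh cB; apply/exists_inP.
exists (window (h + h) h i); first by apply/imsetP; exists (Ordinal ih).
by rewrite (unbiased_representativeE _ h0 evh) ?e // card_window //; lia.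
Qed.

Local Open Scope ring_scope.

(** * Krawtchouk values: recurrence and character sums *)

Definition krawtchouk (m u j : nat) : rat :=
  ((1 - 'X) ^+ j * (1 + 'X) ^+ (m - j))`_u.

Lemma krawtchouk_rec (m u j : nat) : (j < m)%N ->
  (m%:R - j%:R) * krawtchouk m u j.+1 + j%:R * krawtchouk m u j.-1
  = (m%:R - 2 * u%:R) * krawtchouk m u j.
Proof.
move=> jm; pose P i : {poly rat} := (1 - 'X) ^+ i * (1 + 'X) ^+ (m - i).
have dX (p : {poly rat}) : ('X * p^`())`_u = u%:R * p`_u.
  rewrite coefXM; case: u => [|u] /=; first by rewrite mul0r.
  by rewrite coef_deriv mulr_natl.
have key : (m%:R - j%:R) *: P j.+1 + j%:R *: P j.-1
    = m%:R *: P j - 2 *: ('X * (P j)^`()).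
  have [k mE] : exists k, m = (j + k.+1)%N by exists (m - j.+1)%N; lia.
  rewrite /P mE derivM !deriv_exp !derivE.
  have -> : (j + k.+1 - j.+1 = k)%N by lia.
  have -> : (j + k.+1 - j = k.+1)%N by lia.
  rewrite -!mul_polyC !(rmorphB, rmorphD, rmorph_nat) /=.
  case: j {jm mE} => [|j] /=.
    by rewrite subn0 add0n !polyC1 !exprS; ring.
  have -> : (j.+1 + k.+1 - j = k.+2)%N by lia.
  by rewrite !polyC1 !exprS; ring.
move/(congr1 (fun p : {poly rat} => p`_u)): key => /=.
rewrite !(coefB, coefD, coefZ) dX /krawtchouk -!/(P _) => ->; ring.
Qed.

Lemma prod_add1 (R : comNzRingType) (I : finType) (S : {set I}) (f : I -> R) :
  \prod_(i in S) (f i + 1) = \sum_(U in powerset S) \prod_(i in U) f i.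
Proof.
rewrite big_mkcond /=.
rewrite (eq_bigr (fun i => (if i \in S then f i else 0) + 1)); last first.
  by move=> i _; case: (i \in S); rewrite ?add0r.
rewrite bigA_distr [RHS]big_mkcond; apply: eq_big => //= U _.
rewrite powersetE; have [US|/subsetPn[i iU iS]] := boolP (U \subset S).
  by rewrite -big_mkcond; apply: eq_bigr => i /(subsetP US) ->.
by rewrite (bigD1 i) //= iU (negbTE iS) mul0r.
Qed.

Lemma prod_sign_mem (I : finType) (U Y : {set I}) :
  \prod_(i in U) (-1) ^+ (i \in Y) = (-1) ^+ #|U :&: Y| :> rat.
Proof.
rewrite prodrXr; congr (_ ^+ _).
rewrite -sum1_card [RHS]big_mkcond [LHS]big_mkcond /=.
by apply: eq_bigr => i _; rewrite inE; case: (i \in U); case: (i \in Y).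
Qed.

(** Generating function: expand the product over [S] of 1 - X on [Y] and 1 + X off [Y]; the
    u-subsets give the coefficient of X^u. *)
Lemma sum_sign_krawtchouk (I : finType) (S Y : {set I}) (u : nat) :
  \sum_(U : {set I} | (U \subset S) && (#|U| == u)) (-1) ^+ #|U :&: Y|
  = krawtchouk #|S| u #|S :&: Y|.
Proof.
pose s i : {poly rat} := (-1) ^+ (i \in Y) *: 'X.
have prodE : \prod_(i in S) (s i + 1)
    = (1 - 'X) ^+ #|S :&: Y| * (1 + 'X) ^+ (#|S| - #|S :&: Y|).
  rewrite (bigID (mem Y)) /= -(cardsID Y S) addKn.
  rewrite (eq_bigl (mem (S :&: Y))); last by move=> i; rewrite !inE.
  rewrite [X in _ * X](eq_bigl (mem (S :\: Y))); last first.
    by move=> i; rewrite !inE andbC.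
  congr (_ * _).
    rewrite -prodr_const; apply: eq_bigr => i; rewrite /s => /setIP[_ ->].
    by rewrite expr1 scaleN1r addrC.
  rewrite -prodr_const; apply: eq_bigr => i.
  by rewrite /s => /setDP[_ /negbTE ->]; rewrite expr0 scale1r addrC.
rewrite /krawtchouk -prodE prod_add1 coef_sum.
under [RHS]eq_bigl do rewrite powersetE.
rewrite big_mkcondr; apply: eq_bigr => U US.
rewrite scaler_prod prodr_const coefZ coefXn eq_sym.
by rewrite prod_sign_mem; case: eqP => _ /=; rewrite ?mulr0 ?mulr1.
Qed.

Lemma krawtchouk0_gt0 (m u : nat) : (u <= m)%N -> 0 < krawtchouk m u 0.
Proof.
move=> um; have := sum_sign_krawtchouk [set: 'I_m] set0 u.
rewrite setI0 cards0 cardsT card_ord => <-.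
under eq_bigr do rewrite setI0 cards0 expr0.
by rewrite sumr_const ltr0n -cardsE cards_draws cardsT card_ord bin_gt0.
Qed.

(** Complementing [Y] multiplies the sign of each u-subset by (-1)^u = 1. *)
Lemma krawtchoukC (I : finType) (S Y : {set I}) (u : nat) : ~~ odd u ->
  krawtchouk #|S| u #|S :&: ~: Y| = krawtchouk #|S| u #|S :&: Y|.
Proof.
move=> evu; rewrite -!sum_sign_krawtchouk; apply: eq_bigr => U /andP[_ /eqP cU].
rewrite -signr_odd -[RHS]signr_odd; congr (_ ^+ nat_of_bool _).
by move: evu; rewrite -cU -(cardsID Y U) setDE oddD negb_add => /eqP.
Qed.

(* Evaluated at (K j, K j.+1), this form is nonincreasing in j <= m/2: multiply
   the recurrence by K j.+1 - K j.-1. *)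
Definition krawtchouk_energy (m u : nat) (x y : rat) : rat :=
  m%:R / 2 * (x ^+ 2 + y ^+ 2) - (m%:R - 2 * u%:R) * x * y.

(** * Krawtchouk bounds for u between h/8 and h/4 *)

Section KrawtchoukBounds.

Variables h u : nat.
Hypotheses (h_le8u : (h <= 8 * u)%N) (le4u_h : (4 * u <= h)%N) (h_gt0 : (0 < h)%N).

(** The size of the complement of a set of h - u points among 2h. *)
Let m := (h + u)%N.
Let K := krawtchouk m u.

(** Induction on the ratio of consecutive values. With x = j+1, the recurrence and the previous
    bounds put the next ratio between (h-u-2x)/(h+u-x) and (h-u-x)/(h+u-x). The first is at least
    1/2 as u <= h/4 and x <= h/12; the second is at most (h-u)/(h+u) <= 7/9 as u >= h/8. *)
Lemma krawtchouk_pos_decay (j : nat) : (12 * j <= h)%N ->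
  0 < K j /\ K j / 2 <= K j.+1 <= 7 / 9 * K j.
Proof.
have u_gt0 : (0 : rat) < u%:R by rewrite ltr0n; lia.
have h8u : (h%:R : rat) <= 8 * u%:R by rewrite -natrM ler_nat.
have u4h : (4 * u%:R : rat) <= h%:R by rewrite -natrM ler_nat.
elim: j => [|j IHj] jh.
  have K0 : 0 < K 0 by apply: krawtchouk0_gt0; rewrite /m; lia.
  have := @krawtchouk_rec m u 0; rewrite -/K -/(K 1) -/(K 0) /m natrD.
  rewrite mul0r addr0 subr0 => /(_ _) rec0.
  have {}rec0 := rec0 (ltn_addr _ h_gt0).
  by split => //; apply/andP; split; nra.
have [|Kj /andP[Kge Kle]] := IHj; first by lia.
have jh' : (12 * j.+1%:R : rat) <= h%:R by rewrite -natrM ler_nat.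
have := @krawtchouk_rec m u j.+1; rewrite -/K -/(K _) /= /m natrD => recj.
have {}recj : (h%:R + u%:R - j.+1%:R) * K j.+2 + j.+1%:R * K j
   = (h%:R + u%:R - 2 * u%:R) * K j.+1 by apply: recj; lia.
have j0 : (0 : rat) < j.+1%:R by rewrite ltr0n.
split; first by lra.
apply/andP; split.
  have : j.+1%:R * K j <= j.+1%:R * (2 * K j.+1) by rewrite ler_pM2l //; lra.
  have : 0 < K j.+1 by lra.
  move: recj jh' j0 h8u u4h u_gt0.
  move: (j.+1%:R : rat) (h%:R : rat) (u%:R : rat) (K _) (K _) (K _).
  move=> x H U a b c *; nra.
have : j.+1%:R * K j.+1 <= j.+1%:R * K j by rewrite ler_pM2l //; lra.
have : 0 < K j.+1 by lra.
move: recj jh' j0 h8u u4h u_gt0.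
move: (j.+1%:R : rat) (h%:R : rat) (u%:R : rat) (K _) (K _) (K _).
move=> x H U a b c *; nra.
Qed.

Lemma krawtchouk_le_expr (j : nat) : (12 * j <= h)%N ->
  K j <= (7 / 9) ^+ j * K 0.
Proof.
elim: j => [|j IHj] jh; first by rewrite expr0 mul1r.
have jh' : (12 * j <= h)%N by lia.
have [_ /andP[_ Kle]] := krawtchouk_pos_decay jh'.
by have := IHj jh'; rewrite exprS; lra.
Qed.

Lemma krawtchouk_energy_decr (i j : nat) : (i <= j)%N -> (2 * j <= m)%N ->
  krawtchouk_energy m u (K j) (K j.+1) <= krawtchouk_energy m u (K i) (K i.+1).
Proof.
elim: j => [|j IHj]; first by rewrite leqn0 => /eqP ->.
rewrite leq_eqVlt ltnS => /orP[/eqP -> //|ij] jm.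
apply: le_trans (IHj ij _); last by lia.
have jm' : (2 * j.+1%:R : rat) <= m%:R by rewrite -natrM ler_nat.
have := @krawtchouk_rec m u j.+1; rewrite -/K /= => recj.
have {}recj := recj ltac:(lia).
rewrite -subr_le0.
have -> : krawtchouk_energy m u (K j.+1) (K j.+2)
    - krawtchouk_energy m u (K j) (K j.+1)
    = (j.+1%:R - m%:R / 2) * (K j.+2 - K j) ^+ 2.
  rewrite /krawtchouk_energy.
  transitivity (m%:R / 2 * (K j.+2 ^+ 2 - K j ^+ 2)
      - (m%:R - 2 * u%:R) * K j.+1 * (K j.+2 - K j)); first by ring.
  by rewrite -recj; field.
by apply: mulr_le0_ge0; [lra | exact: sqr_ge0].
Qed.

Lemma krawtchouk_ge (j : nat) : (2 * j <= m)%N ->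
  - (3 * (7 / 9) ^+ (h %/ 12) * K 0) <= K j.
Proof.
move=> jm; set J := (h %/ 12)%N.
have Jh : (12 * J <= h)%N by rewrite mulnC leq_trunc_div.
have K0 : 0 < K 0 by apply: krawtchouk0_gt0; rewrite /m; lia.
have q0 : 0 < 7 / 9 :> rat by lra.
have pJ := exprn_gt0 J q0.
have [jJ|/ltnW Jj] := leqP j J.
  have [Kj _] := @krawtchouk_pos_decay j ltac:(lia).
  by apply: le_trans (ltW Kj); rewrite oppr_le0; nra.
have KJ := krawtchouk_le_expr Jh.
have [KJ0 /andP[KJ1 KJ2]] := krawtchouk_pos_decay Jh.
(* The energy at (a, b) is u (a^2 + b^2) + (h-u)/2 (a-b)^2, hence at least u a^2. At J it is at most
   (h+u) K(J)^2 <= 9 u K(J)^2, whence the factor 3. *)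
suff sq : K j ^+ 2 <= 9 * K J ^+ 2.
  suff : - (3 * K J) <= K j by lra.
  by rewrite leNgt; apply/negP => lt; nra.
have := krawtchouk_energy_decr Jj jm; rewrite /krawtchouk_energy.
have u_gt0 : (0 : rat) < u%:R by rewrite ltr0n; lia.
have h8u : (h%:R : rat) <= 8 * u%:R by rewrite -natrM ler_nat.
have u4h : (4 * u%:R : rat) <= h%:R by rewrite -natrM ler_nat.
rewrite /m natrD; move: u_gt0 h8u u4h KJ0 KJ1 KJ2.
move: (h%:R : rat) (u%:R : rat) (K J) (K J.+1) (K j) (K j.+1) => H U x y a b.
move=> U0 HU UH x0 yx xy E.
have lo : U * a ^+ 2 <= (H + U) / 2 * (a ^+ 2 + b ^+ 2) - (H + U - 2 * U) * a * b.
  have := mulr_ge0 (_ : 0 <= (H - U) / 2) (sqr_ge0 (a - b)).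
  have := mulr_ge0 (ltW U0) (sqr_ge0 b).
  by move=> b1 /(_ ltac:(lra)); nra.
have hi : (H + U) / 2 * (x ^+ 2 + y ^+ 2) - (H + U - 2 * U) * x * y
    <= (H + U) * x ^+ 2.
  have xy2 : y ^+ 2 <= x ^+ 2 by nra.
  have xy0 : 0 <= x * y by nra.
  have : 0 <= (H - U) * (x * y) by apply: mulr_ge0; lra.
  have : 0 <= (H + U) * (x ^+ 2 - y ^+ 2) by apply: mulr_ge0; lra.
  by nra.
have fin : (H + U) * x ^+ 2 <= 9 * U * x ^+ 2.
  by apply: ler_wpM2r; [exact: sqr_ge0 | lra].
rewrite -(ler_pM2l U0); nra.
Qed.

End KrawtchoukBounds.

Local Close Scope ring_scope.

(** * Sets meeting every member of a family evenly *)

Definition even_for (I : finType) (G : {set {set I}}) (X : {set I}) : bool :=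
  [forall A in G, ~~ odd #|A :&: X|].

Lemma odd_card_symdiff (I : finType) (A X Y : {set I}) :
  odd #|A :&: ((X :\: Y) :|: (Y :\: X))|
  = odd #|A :&: X| (+) odd #|A :&: Y|.
Proof.
rewrite -(cardsID Y (A :&: X)) -(cardsID X (A :&: Y)).
have -> : A :&: Y :&: X = A :&: X :&: Y by rewrite setIAC.
have disj : A :&: (X :\: Y) :&: (A :&: (Y :\: X)) = set0.
  by apply/setP => i; rewrite !inE; case: (i \in X); rewrite ?andbF.
rewrite setIUr cardsU disj cards0 subn0 !setIDA !oddD.
by rewrite addbACA addbb addFb.
Qed.

Lemma exists_subset_card (I : finType) (S : {set I}) (k : nat) :
  k <= #|S| -> exists2 R : {set I}, R \subset S & #|R| = k.
Proof.
move=> kS; exists [set x in take k (enum S)].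
  by apply/subsetP => x; rewrite inE => /mem_take; rewrite mem_enum.
rewrite cardsE (card_uniqP _) ?take_uniq ?enum_uniq //.
by rewrite size_takel // -cardE.
Qed.

(* Pigeonhole: two subsets of R have the same parities against G, so their
   symmetric difference is even. *)
Lemma even_for_exists (I : finType) (G : {set {set I}}) (R : {set I}) :
  #|G| < #|R| ->
  exists X : {set I}, [/\ X \subset R, X != set0 & even_for G X].
Proof.
move=> GR; pose par (X : {set I}) := [set A in G | odd #|A :&: X|].
have /dinjectivePn[X XR [Y]] : ~~ dinjectiveb par (mem (powerset R)).
  apply/negP => /dinjectiveP/card_in_imset cpar.
  have : par @: powerset R \subset powerset G.
    apply/subsetP => _ /imsetP[X _ ->]; rewrite powersetE.
    by apply/subsetP => A; rewrite inE => /andP[].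
  by move/subset_leq_card; rewrite cpar !card_powerset leq_exp2l // leqNgt GR.
rewrite !inE => /andP[nYX YR] parXY; rewrite inE in XR.
exists ((X :\: Y) :|: (Y :\: X)); split.
- by rewrite subUset !subDset !subsetU ?XR ?YR ?orbT.
- apply: contra nYX; rewrite setU_eq0 !setD_eq0 => /andP[XY YX].
  by rewrite eqEsubset YX XY.
apply/forall_inP => A AG; rewrite odd_card_symdiff.
by have /setP/(_ A) := parXY; rewrite !inE AG /= => ->; rewrite addbb.
Qed.

Lemma even_forU (I : finType) (G : {set {set I}}) (X Y : {set I}) :
  [disjoint X & Y] -> even_for G X -> even_for G Y -> even_for G (X :|: Y).
Proof.
rewrite -setI_eq0 => /eqP XY /forall_inP eX /forall_inP eY.
apply/forall_inP => A AG; rewrite setIUr cardsU setIACA XY setI0 cards0 subn0.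
by rewrite oddD (negbTE (eX A AG)) (negbTE (eY A AG)).
Qed.

(** Take a largest even T with at most t points. If |T| + |G| < t, then |G| + 1 points outside T
    contain a nonempty even set, and adding it to T stays within t. *)
Lemma even_for_card_near (I : finType) (G : {set {set I}}) (t : nat) :
  #|G| + t < #|I| ->
  exists T : {set I}, [/\ even_for G T, #|T| <= t & t <= #|T| + #|G|].
Proof.
move=> Gt; pose P (T : {set I}) := even_for G T && (#|T| <= t).
have P0 : P set0.
  rewrite /P cards0 andbT; apply/forall_inP => A _.
  by rewrite setI0 cards0.
case: (arg_maxnP (fun T : {set I} => #|T|) P0) => T /andP[eT Tt] maxT.
exists T; split => //; rewrite leqNgt; apply/negP => TGt.
have [|R RT cR] := @exists_subset_card _ (~: T) #|G|.+1.
  by have := cardsC T; lia.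
have [|X [XR X0 eX]] := @even_for_exists _ G R; first by rewrite cR.
have dTX : [disjoint T & X].
  by rewrite disjoint_sym disjoints_subset (subset_trans XR).
have cTX : #|T :|: X| = #|T| + #|X|.
  by rewrite cardsU disjoint_setI0 // cards0 subn0.
have cX : #|X| <= #|G|.+1 by rewrite -cR subset_leq_card.
have := maxT (T :|: X); rewrite /P even_forU //= cTX => /(_ _).
by move: X0; rewrite -card_gt0 => X0 /(_ ltac:(lia)); lia.
Qed.

Local Open Scope ring_scope.

(** * Even subsets of prescribed size, by characters *)

(** A product of characters is the character of the symmetric difference, the set of points lying in
    an odd number of members. *)
Lemma prod_sign_cardI (I : finType) (G : {set {set I}}) (U : {set I}) :
  \prod_(A in G) (-1) ^+ #|A :&: U|
  = (-1) ^+ #|U :&: [set i | odd #|[set A in G | i \in A]|]| :> rat.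
Proof.
rewrite -prod_sign_mem.
under eq_bigr do rewrite setIC -prod_sign_mem.
rewrite exchange_big /=; apply: eq_bigr => i _.
rewrite inE signr_odd prodrXr; congr (_ ^+ _).
rewrite -sum1_card [RHS]big_mkcond [LHS]big_mkcond /=.
by apply: eq_bigr => A _; rewrite inE; case: (A \in G); case: (i \in A).
Qed.

(* Were no such U even for G, every product of the 1 + (-1)^|A :&: U|, A in G,
   would vanish.  Expanded, their sum over U consists of 2^|G| Krawtchouk values,
   and the one at 0 outweighs all the negative ones together. *)
Lemma even_for_exact (I : finType) (G : {set {set I}}) (S : {set I}) (h u : nat) :
  (0 < h)%N -> (h <= 8 * u)%N -> (4 * u <= h)%N -> ~~ odd u ->
  #|S| = (h + u)%N -> 3 * 2 ^+ #|G| * (7 / 9) ^+ (h %/ 12) < 1 :> rat ->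
  exists U : {set I}, [/\ U \subset S, #|U| = u & even_for G U].
Proof.
move=> h0 h8u u4h evu cS.
have q0 : 0 <= 7 / 9 :> rat by lra.
have := krawtchouk_ge h8u u4h h0; have := exprn_ge0 (h %/ 12) q0.
move: (_ ^+ (h %/ 12)) {q0} => r r0 K_ge small.
have [/existsP[U /and3P[US /eqP cU eU]]|/existsPn noU] := boolP
    [exists U : {set I}, [&& U \subset S, #|U| == u & even_for G U]].
  by exists U.
exfalso.
pose g (F : {set {set I}}) := \sum_(U : {set I} | (U \subset S) && (#|U| == u))
  \prod_(A in F) ((-1) ^+ #|A :&: U| : rat).
have sum0 : \sum_(F in powerset G) g F = 0.
  rewrite exchange_big /= big1 // => U /andP[US cU].
  have := noU U; rewrite US cU /= => /forall_inPn[A AG oA].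
  transitivity (\prod_(B in G) ((-1) ^+ #|B :&: U| + 1 : rat)).
    by rewrite prod_add1.
  rewrite (bigD1 A) //= -signr_odd; move: oA; rewrite negbK => ->.
  by rewrite addNr mul0r.
pose K := krawtchouk (h + u) u.
pose Y (F : {set {set I}}) := [set i | odd #|[set A in F | i \in A]|] : {set I}.
have gE F : g F = K #|S :&: Y F|.
  rewrite /K -cS -sum_sign_krawtchouk; apply: eq_bigr => U _.
  exact: prod_sign_cardI.
(* Shifting by [c] makes all 2^|G| terms nonnegative, so their sum 2^|G| c is at least the term K(0)
   + c of the empty subfamily; but [small] says 2^|G| c < K(0). *)
pose c := 3 * r * K 0.
have g_ge F : 0 <= g F + c.
  rewrite -[c]opprK subr_ge0 gE.
  have [le|lt] := leqP (2 * #|S :&: Y F|) (h + u); first exact: K_ge.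
  have <- : K #|S :&: ~: Y F| = K #|S :&: Y F| by rewrite /K -cS krawtchoukC.
  apply: K_ge.
  by have := cardsID (Y F) S; rewrite setDE cS; lia.
have g0 : g set0 = K 0.
  rewrite gE (_ : Y set0 = set0) ?setI0 ?cards0 //.
  apply/setP => i; rewrite !inE (_ : [set A in set0 | _] = set0) ?cards0 //.
  by apply/setP => A; rewrite !inE.
have K0 : 0 < K 0 by apply: krawtchouk0_gt0; lia.
have sumc : \sum_(F in powerset G) (g F + c) = 2 ^+ #|G| * c.
  by rewrite big_split /= sum0 add0r sumr_const card_powerset -natrX mulr_natl.
have lec : K 0 + c <= 2 ^+ #|G| * c.
  rewrite -sumc (bigD1 set0) ?powersetE ?sub0set //= g0 lerDl.
  by apply: sumr_ge0.
have c_ge0 : 0 <= c by rewrite mulr_ge0 ?(ltW K0) // mulr_ge0.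
have ltc : 2 ^+ #|G| * c < K 0.
  by rewrite /c !mulrA [2 ^+ _ * 3]mulrC -[ltRHS]mul1r ltr_pM2r.
by have := le_lt_trans lec ltc; rewrite gtrDl ltNge c_ge0.
Qed.

(** For g >= 1, 3 * 2^g <= 6^g, and 6 (7/9)^12 < 1. *)
Lemma pow2_expr_lt1 (g k : nat) : (0 < g)%N -> (12 * g <= k)%N ->
  3 * 2 ^+ g * (7 / 9) ^+ k < 1 :> rat.
Proof.
(* The base is hidden because unification would otherwise try to compute its
   powers. *)
move=> g0 gk; have [q [qE q0 q1 q12]] :
    exists q : rat, [/\ 7 / 9 = q, 0 <= q, q <= 1 & 6 * q ^+ 12 < 1].
  by exists (7 / 9); split; [by [] | lra | lra | lra].
rewrite qE; apply: (@le_lt_trans _ _ ((6 * q ^+ 12) ^+ g)); last first.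
  by rewrite exprn_ilt1 -?lt0n // mulr_ge0 ?exprn_ge0.
rewrite exprMn -exprM; apply: ler_pM.
- by rewrite mulr_ge0 ?exprn_ge0.
- by rewrite exprn_ge0.
- rewrite (_ : 6 = 3 * 2) ?exprMn; last by ring.
  by rewrite ler_wpM2r ?exprn_ge0 // ler_eXnr // ler1n.
exact: ler_wiXn2l.
Qed.

Lemma even_for_half (I : finType) (G : {set {set I}}) (h : nat) :
  ~~ odd h -> #|I| = (h + h)%N -> (0 < #|G|)%N -> (500 * #|G| <= h)%N ->
  exists2 X : {set I}, #|X| = h & even_for G X.
Proof.
move=> evh cI G0 Gh.
(* Adding the full set to the family forces |T| to be even. *)
have [G' [G'G TG' /subsetP GG']] :
    exists G' : {set {set I}},
      [/\ (#|G'| <= #|G|.+1)%N, setT \in G' & G \subset G'].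
  exists (setT |: G); rewrite setU11 subsetUr cardsU1.
  by rewrite -add1n leq_add2r leq_b1.
(* With this target, u = h - |T| exceeds h/8 and is at most h/8 + |G| + 2, which is below h/4 as 500
   |G| <= h. *)
have [|T [eT Tle Tge]] := @even_for_card_near I G' (h - (h %/ 8).+1).
  by rewrite cI; lia.
have /forall_inP evT := eT.
have evcT : ~~ odd #|T| by have := evT setT TG'; rewrite setTI.
have [] := @even_for_exact I G (~: T) h (h - #|T|).
- lia.
- lia.
- lia.
- by rewrite oddB ?(negbTE evh) ?(negbTE evcT) //; lia.
- by have := cardsC T; rewrite cI; lia.
- by apply: pow2_expr_lt1 => //; lia.
move=> U [UT cU eU]; exists (T :|: U).
  have dTU : [disjoint T & U] by rewrite disjoint_sym disjoints_subset.
  by rewrite cardsU disjoint_setI0 // cards0 cU; lia.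
apply: even_forU => //; first by rewrite disjoint_sym disjoints_subset.
by apply/forall_inP => A AG; apply: evT (GG' A AG).
Qed.

(** * Lower bound and conclusion *)

Lemma gamma_half_ge (h : nat) : (0 < h)%N -> ~~ odd h -> odd h./2 ->
  (h <= 500 * gamma (h + h) h h)%N.
Proof.
move=> h0 evh oh; set n := (h + h)%N; set BB := k_bicolorings n h.
apply: (@leq_trans (500 * min_SUR_card h BB)); last first.
  by rewrite leq_mul2l; apply: (@leq_bigmax_cond _ _ _ BB).
have n2 : (n %/ 2 = h)%N by rewrite /n addnn -muln2 mulnK.
have sur0 : is_uniform_SUR h (r_sets n h) BB.
  have := @r_sets_half_SUR n BB; rewrite n2; apply; rewrite ?subxx //.
    by rewrite /n; lia.
  by rewrite /n addnn -muln2 dvdn_mull.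
have [[G /andP[/subsetP sG /forall_inP surG] ->] _] := min_SUR_cardP sur0.
rewrite leqNgt; apply/negP => Gh.
have repG (X : {set 'I_n}) : #|X| = h ->
    exists2 A, A \in G & #|A :&: X| = h./2.
  move=> cX; pose B : bicoloring n := [ffun i => i \in X].
  have XE : [set i | B i] = X by apply/setP => i; rewrite inE ffunE.
  have /surG/exists_inP[A AG rA] : B \in BB by rewrite k_bicoloringsE XE cX.
  have := sG A AG; rewrite inE => /eqP cA; exists A => //.
  by move: rA; rewrite (unbiased_representativeE _ h0 evh cA) XE => /eqP.
(* [even_for_half] requires a nonempty [G]: representing any one h-set provides a member. *)
have [X0 _ cX0] := @exists_subset_card _ [set: 'I_n] h
  ltac:(by rewrite cardsT card_ord leq_addr).
have [A0 A0G _] := repG X0 cX0.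
have [||X cX /forall_inP eX] := @even_for_half _ G h evh (card_ord _).
- by rewrite card_gt0; apply/set0Pn; exists A0.
- exact: ltnW.
by have [A AG cAX] := repG X cX; have := eX A AG; rewrite cAX oh.
Qed.

Local Close Scope ring_scope.

Theorem theorem9 (R : realType) :
  (forall n : nat, 0 < n -> 2 %| n -> ~~ odd (n %/ 2) ->
     gamma n (n %/ 2) (n %/ 2) <= n %/ 2)
  /\
  (exists2 delta : R, (0 < delta < 1)%R &
     forall n : nat, 0 < n -> 2 %| n -> ~~ odd (n %/ 2) -> odd (n %/ 4) ->
       (delta * n%:R <= (gamma n (n %/ 2) (n %/ 2))%:R)%R).
Proof.
have half n : 2 %| n -> n = n %/ 2 + n %/ 2 by rewrite addnn -muln2 => /divnK.
split=> [n n0 n2 evh|].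
  by rewrite {1}(half n n2); apply: gamma_half_le => //; lia.
(* n = 2h and h <= 500 gamma give n <= 1000 gamma. *)
exists (1000%:R^-1)%R; first
  by rewrite invr_gt0 ltr0n invf_lt1 ?ltr0n ?ltr1n.
move=> n n0 n2 evh oq.
have oh : odd (n %/ 2)./2 by rewrite -divn2 -divnMA.
rewrite mulrC ler_pdivrMr ?ltr0n // -natrM ler_nat.
have := gamma_half_ge _ evh oh; rewrite -(half n n2) => /(_ _) H.
by have := H ltac:(lia); have := half n n2; lia.
Qed.
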